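(* Let $(A,\mathfrak{m})$ be a commutative Noetherian local ring. Let $\mathcal{T}$ be a thick subcategory of $K^b(\operatorname{proj} A)$ and let $X \in \mathcal{T}$. Let $m = \operatorname{width} X$ and $r = \operatorname{rank} X$. Suppose $\mathcal{T}$ has only finitely many complexes (up to isomorphism and shift) with width $\leq 2m$ and rank $\leq 2r$. Then $H^*(X)$ has finite length.
   Context: $K^b(\operatorname{proj} A)$ is the homotopy category of bounded cochain complexes of finitely generated free $A$-modules, and $H^*(X)=\bigoplus_i H^i(X)$. A bounded complex $U$ of finitely generated free $A$-modules is minimal if $\partial(U)\subseteq \mathfrak{m}U$; for such $U$ set $\operatorname{width} U = \sup\{i \mid U^i\neq 0\} - \inf\{i\mid U^i\neq 0\}$ and $\operatorname{rank} U = \sum_i \operatorname{rank} U^i$. Every bounded complex $X$ of finitely generated free $A$-modules decomposes as $X = U\oplus V$ with $U$ minimal and $V$ a finite direct sum of shifts of $0\to A\xrightarrow{1} A\to 0$; set $\operatorname{width} X=\operatorname{width} U$ and $\operatorname{rank} X=\operatorname{rank} U$. These are well defined on objects of $K^b(\operatorname{proj} A)$.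
   Formalization: The formal theorem also assumes that width X ≥ 1 whenever X is nonzero (rank X ≥ 1); without this the claim fails, e.g. for A a discrete valuation ring, T = K^b(proj A) and X = A in degree 0, where m = 0. *)

(* Defs.v *)
From HB Require Import structures.
From mathcomp Require Import all_boot all_order all_algebra.
From mathcomp Require Import ring_quotient zify.
From mathcomp Require Import boolp classical_sets cardinality fsbigop.

Set Implicit Arguments.
Unset Strict Implicit.
Unset Printing Implicit Defensive.

Import GRing.Theory.
Local Open Scope ring_scope.
Local Open Scope quotient_scope.

Section QuotientModule.
Variables (R : nzRingType) (M : lmodType R).
Variables (N : {pred M}) (Nsub : submod_closed N).

Let Nzmod : zmodClosed M :=
  HB.pack N (GRing.isZmodClosed.Build M N (GRing.submod_closedB Nsub)).

Definition quotient_module : Type := @Quotient.quot M Nzmod.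

HB.instance Definition _ := GRing.Zmodule.on quotient_module.

Definition quotient_map (x : M) : quotient_module := \pi_(@Quotient.quot M Nzmod) x.

Lemma quotient_mapP (q : quotient_module) : exists x, q = quotient_map x.
Proof. by exists (repr (q : @Quotient.quot M Nzmod)); rewrite /quotient_map reprK. Qed.

Lemma quotient_map_eq x y : quotient_map x = quotient_map y <-> x - y \in N.
Proof.
have -> : (x - y \in N) = (quotient_map x == quotient_map y).
  exact: (@Quotient.idealrBE M Nzmod x y).
by split=> /eqP.
Qed.

Lemma quotient_mapD x y : quotient_map (x + y) = quotient_map x + quotient_map y.
Proof. exact: (@Quotient.pi_add M Nzmod x y). Qed.

Definition quotient_scale (a : R) (q : quotient_module) : quotient_module :=
  quotient_map (a *: repr (q : @Quotient.quot M Nzmod)).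

Lemma quotient_mapZ a x : quotient_map (a *: x) = quotient_scale a (quotient_map x).
Proof.
apply/quotient_map_eq; rewrite -scalerBr -[_ *: _]addr0.
apply: Nsub.2; last exact: Nsub.1.
by apply/quotient_map_eq; rewrite {2}/quotient_map reprK.
Qed.

Fact quotient_scaleA a b q :
  quotient_scale a (quotient_scale b q) = quotient_scale (a * b) q.
Proof. by have [x ->] := quotient_mapP q; rewrite -!quotient_mapZ scalerA. Qed.

Fact quotient_scale1 : left_id 1 quotient_scale.
Proof. by move=> q; have [x ->] := quotient_mapP q; rewrite -quotient_mapZ scale1r. Qed.

Fact quotient_scaleDr : right_distributive quotient_scale +%R.
Proof.
move=> a p q; have [x ->] := quotient_mapP p; have [y ->] := quotient_mapP q.
by rewrite -quotient_mapD -!quotient_mapZ -quotient_mapD scalerDr.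
Qed.

Fact quotient_scaleDl q : {morph quotient_scale^~ q : a b / a + b}.
Proof.
move=> a b; have [x ->] := quotient_mapP q.
by rewrite -!quotient_mapZ -quotient_mapD scalerDl.
Qed.

HB.instance Definition _ := GRing.Zmodule_isLmodule.Build R quotient_module
  quotient_scaleA quotient_scale1 quotient_scaleDr quotient_scaleDl.

End QuotientModule.

Section DirectSum.
Variables (R : nzRingType) (I : choiceType) (M : I -> lmodType R).

Definition product_module : Type := forall i, M i.

HB.instance Definition _ := gen_eqMixin product_module.
HB.instance Definition _ := gen_choiceMixin product_module.

Let add (x y : product_module) : product_module := fun i => x i + y i.
Let opp (x : product_module) : product_module := fun i => - x i.
Let zero : product_module := fun i => 0.
Let scale (a : R) (x : product_module) : product_module := fun i => a *: x i.

Fact product_addA : associative add.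
Proof. by move=> x y z; apply: functional_extensionality_dep => i; apply: addrA. Qed.
Fact product_addC : commutative add.
Proof. by move=> x y; apply: functional_extensionality_dep => i; apply: addrC. Qed.
Fact product_add0 : left_id zero add.
Proof. by move=> x; apply: functional_extensionality_dep => i; apply: add0r. Qed.
Fact product_addN : left_inverse zero opp add.
Proof. by move=> x; apply: functional_extensionality_dep => i; apply: addNr. Qed.

HB.instance Definition _ := GRing.isZmodule.Build product_module
  product_addA product_addC product_add0 product_addN.

Fact product_scaleA a b (x : product_module) :
  scale a (scale b x) = scale (a * b) x.
Proof. by apply: functional_extensionality_dep => i; apply: scalerA. Qed.
Fact product_scale1 : left_id 1 scale.
Proof. by move=> x; apply: functional_extensionality_dep => i; apply: scale1r. Qed.
Fact product_scaleDr : right_distributive scale +%R.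
Proof. by move=> a x y; apply: functional_extensionality_dep => i; apply: scalerDr. Qed.
Fact product_scaleDl (x : product_module) : {morph scale^~ x : a b / a + b}.
Proof. by move=> a b; apply: functional_extensionality_dep => i; apply: scalerDl. Qed.

HB.instance Definition _ := GRing.Zmodule_isLmodule.Build R product_module
  product_scaleA product_scale1 product_scaleDr product_scaleDl.

Definition finitely_supported : {pred product_module} :=
  fun x => `[< finite_set [set i | x i != 0] >].

Fact finitely_supported_closed : submod_closed finitely_supported.
Proof.
split; first by apply/asboolP; apply: (sub_finite_set _ (finite_set0 I)) => i /=;
  rewrite eqxx.
move=> a x y /asboolP fx /asboolP fy; apply/asboolP.
have fxy : finite_set ([set i | x i != 0] `|` [set i | y i != 0]).
  by rewrite finite_setU.
apply: sub_finite_set fxy => i /= xyi.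
have [xi0|] := eqVneq (x i) 0; last by left.
right; apply: contraNneq xyi => yi0; change (a *: x i + y i == 0).
by rewrite xi0 yi0 scaler0 addr0.
Qed.

HB.instance Definition _ := GRing.isSubmodClosed.Build R product_module
  finitely_supported finitely_supported_closed.

Definition direct_sum : Type := {x : product_module | x \in finitely_supported}.

HB.instance Definition _ := SubChoice.on direct_sum.
HB.instance Definition _ := [SubChoice_isSubLmodule of direct_sum by <:].

End DirectSum.

Section FiniteLength.
Variables (R : nzRingType) (M : lmodType R).

(* N'/N is a simple module *)
Definition simple_factor (N N' : {pred M}) : Prop :=
  [/\ {subset N <= N'}, ~ {subset N' <= N} &
      forall P : {pred M}, submod_closed P ->
        {subset N <= P} -> {subset P <= N'} ->
        {subset P <= N} \/ {subset N' <= P}].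

Definition finite_length : Prop :=
  exists (n : nat) (N : nat -> {pred M}),
    [/\ forall k, submod_closed (N k),
        N 0%N =i pred1 0,
        N n =i predT &
        forall k, (k < n)%N -> simple_factor (N k) (N k.+1)].

End FiniteLength.

Section Rings.
Variable A : comNzRingType.

Definition noetherian : Prop :=
  forall I : {pred A}, submod_closed (I : {pred A^o}) ->
    exists s : seq A, forall x,
      x \in I <-> exists c : nat -> A, x = \sum_(k < size s) c k * s`_k.

(* idealr_closed includes properness *)
Definition maximal_ideal (I : {pred A}) : Prop :=
  idealr_closed I /\
  forall J : {pred A}, idealr_closed J -> {subset I <= J} -> {subset J <= I}.

Definition local_ring (m : {pred A}) : Prop :=
  maximal_ideal m /\ forall n, maximal_ideal n -> n =i m.

(* x \in I M *)
Definition in_ideal_smul (I : {pred A}) (M : lmodType A) (x : M) : Prop :=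
  exists2 s : seq (A * M), {in s, forall p, p.1 \in I} &
    x = \sum_(p <- s) p.1 *: p.2.

End Rings.

(* A vectType over A is a finitely generated free A-module, and [dim] is its
   rank. *)
Record complex (A : comNzRingType) := Complex {
  obj :> int -> vectType A;
  diff : forall i : int, 'Hom(obj i, obj (i + 1));
  diffK : forall i : int, (diff (i + 1) \o diff i = 0)%VF;
  bounded : exists n : nat, forall i : int, (n < `|i|)%N -> dim (obj i) = 0%N
}.
Arguments diff {A} c i.

Section Complexes.
Variable A : comNzRingType.
Implicit Types X Y U V : complex A.

Lemma diff_diff X i x : diff X (i + 1) (diff X i x) = 0.
Proof. by rewrite -comp_lfunE diffK lfunE. Qed.

Record chain_map X Y := ChainMap {
  cmap :> forall i : int, 'Hom(X i, Y i);
  cmap_diff : forall i : int, (cmap (i + 1) \o diff X i = diff Y i \o cmap i)%VF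
}.

Definition homotopic X Y (f g : forall i : int, 'Hom(X i, Y i)) : Prop :=
  exists h : forall i : int, 'Hom(X (i + 1), Y i), forall i : int,
    f (i + 1) - g (i + 1) =
      ((diff Y i \o h i) + (h (i + 1) \o diff X (i + 1)))%VF.

Definition cx_iso X Y : Prop :=
  exists (f : chain_map X Y) (g : chain_map Y X),
    forall i, (g i \o f i = \1)%VF /\ (f i \o g i = \1)%VF.

(* isomorphism in the homotopy category *)
Definition ho_iso X Y : Prop :=
  exists (f : chain_map X Y) (g : chain_map Y X),
    homotopic (fun i => g i \o f i)%VF (fun i => \1)%VF /\
    homotopic (fun i => f i \o g i)%VF (fun i => \1)%VF.

Fact zero_cx_bounded : exists n : nat, forall i : int, (n < `|i|)%N ->
  dim ('rV[A]_0 : vectType A) = 0%N.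
Proof. by exists 0%N => i _; rewrite /dim /= muln0. Qed.

Fact zero_cx_diffK (i : int) :
  ((0 : 'Hom('rV[A]_0, 'rV[A]_0)) \o (0 : 'Hom('rV[A]_0, 'rV[A]_0)) = 0)%VF.
Proof. exact: comp_lfun0l. Qed.

Definition zero_cx : complex A :=
  @Complex A (fun=> 'rV[A]_0) (fun=> 0) zero_cx_diffK zero_cx_bounded.

Lemma prod_dim (V W : vectType A) : dim (V * W)%type = (dim V + dim W)%N.
Proof. by []. Qed.

Section Shift.
Variable X : complex A.
Fact shift_diffK (i : int) : ((- diff X (i + 1 + 1)) \o (- diff X (i + 1)) = 0)%VF.
Proof. by rewrite comp_lfunNl comp_lfunNr diffK !oppr0. Qed.

Lemma bounded_succ :
  exists n : nat, forall i : int, (n < `|i|)%N -> dim (X (i + 1)) = 0%N.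
Proof.
have [n Xn] := bounded X; exists n.+1 => i ni; apply: Xn; lia.
Qed.

Definition shift : complex A :=
  @Complex A (fun i => X (i + 1)) (fun i => - diff X (i + 1))
    shift_diffK bounded_succ.
End Shift.

Section DirectSumComplex.
Variables X Y : complex A.
Let d (i : int) (p : X i * Y i) : (X (i + 1)%R * Y (i + 1)%R)%type :=
  (diff X i p.1, diff Y i p.2).
Fact oplus_linear (i : int) : linear (@d i).
Proof. by move=> a u v; congr (_, _) => /=; rewrite linearP. Qed.
HB.instance Definition _ i :=
  GRing.isLinear.Build A (X i * Y i)%type (X (i + 1)%R * Y (i + 1)%R)%type _ (@d i)
    (@oplus_linear i).
Fact oplus_diffK (i : int) : (linfun (@d (i + 1)) \o linfun (@d i) = 0)%VF.
Proof.
apply/lfunP => x; rewrite !lfunE /= !lfunE.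
by apply: (f_equal2 pair); apply: diff_diff.
Qed.
Fact oplus_bounded : exists n : nat, forall i : int, (n < `|i|)%N ->
  dim (X i * Y i)%type = 0%N.
Proof.
have [n Xn] := bounded X; have [k Yk] := bounded Y.
exists (maxn n k) => i; rewrite gtn_max => /andP[ni ki].
by rewrite prod_dim Xn ?Yk.
Qed.
Definition oplus : complex A :=
  @Complex A (fun i => (X i * Y i)%type) (fun i => linfun (@d i))
    oplus_diffK oplus_bounded.
End DirectSumComplex.

Section Cone.
Variables (X Y : complex A) (f : chain_map X Y).
Let d (i : int) (p : X (i + 1)%R * Y i) : (X (i + 1 + 1)%R * Y (i + 1)%R)%type :=
  (- diff X (i + 1) p.1, f (i + 1) p.1 + diff Y i p.2).
Fact cone_linear (i : int) : linear (@d i).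
Proof.
move=> a u v; congr (_, _) => /=; rewrite !linearP //=.
by rewrite scalerDr addrACA.
Qed.
HB.instance Definition _ i :=
  GRing.isLinear.Build A (X (i + 1)%R * Y i)%type
    (X (i + 1 + 1)%R * Y (i + 1)%R)%type _ (@d i) (@cone_linear i).
Fact cone_diffK (i : int) : (linfun (@d (i + 1)) \o linfun (@d i) = 0)%VF.
Proof.
apply/lfunP => x; rewrite !lfunE /= !lfunE; apply: (f_equal2 pair).
  by rewrite /= linearN opprK; apply: diff_diff.
rewrite /= linearN linearD /=.
rewrite [X in _ + (_ + X)](_ : _ = 0) ?addr0; last exact: diff_diff.
have /lfunP/(_ x.1) := cmap_diff f (i + 1); rewrite !comp_lfunE => <-.
exact: addNr.
Qed.
Fact cone_bounded : exists n : nat, forall i : int, (n < `|i|)%N ->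
  dim (X (i + 1)%R * Y i)%type = 0%N.
Proof.
have [n Xn] := bounded_succ X; have [k Yk] := bounded Y.
exists (maxn n k) => i; rewrite gtn_max => /andP[ni ki].
by rewrite prod_dim Xn ?Yk.
Qed.
Definition cone : complex A :=
  @Complex A (fun i => (X (i + 1)%R * Y i)%type) (fun i => linfun (@d i))
    cone_diffK cone_bounded.
End Cone.

(* 0 -> A -1-> A -> 0 in degrees n and n + 1: as the entries are row vectors of
   size 0 outside these degrees, the constant matrix 1 gives every differential. *)
Section Disk.
Variable n : int.
Let e (i : int) : nat := (i == n) || (i == n + 1).
Let d (i : int) : 'Hom('rV[A]_(e i), 'rV[A]_(e (i + 1))) :=
  linfun (mulmxr (const_mx 1 : 'M[A]_(e i, e (i + 1)))).
Fact disk_diffK (i : int) : (d (i + 1) \o d i = 0)%VF.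
Proof.
apply/lfunP => x; apply/rowP => j; rewrite !lfunE /= !lfunE /= !mxE.
have [ei0|ej0] : (e i = 0 \/ e (i + 1 + 1) = 0)%N by rewrite /e; lia.
  rewrite big1 // => k _; rewrite mxE big1 ?mul0r // => l _.
  by case: l => l ll; exfalso; move: ll; rewrite ei0.
by case: j => j jl; exfalso; move: jl; rewrite ej0.
Qed.
Fact disk_bounded :
  exists k : nat, forall i : int, (k < `|i|)%N -> dim 'rV[A]_(e i) = 0%N.
Proof.
exists (`|n|.+1)%N => i ni; have -> : e i = 0%N by rewrite /e; lia.
by rewrite /dim /= muln0.
Qed.
Definition disk : complex A := @Complex A (fun i => 'rV[A]_(e i)) d
  disk_diffK disk_bounded.
End Disk.

Definition minimal (m : {pred A}) U : Prop :=
  forall (i : int) (x : U i), in_ideal_smul m (diff U i x).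

(* U is the minimal summand in a decomposition X = U (+) V, where V is a finite
   direct sum of shifts of 0 -> A -1-> A -> 0. *)
Definition minimal_part (m : {pred A}) X U : Prop :=
  minimal m U /\
  exists s : seq int, cx_iso X (oplus U (foldr oplus zero_cx (map disk s))).

(* sup - inf of the support; the zero complex is given width 0 *)
Definition spread U (w : nat) : Prop :=
  (exists a : int, [/\ dim (U a) != 0%N, dim (U (a + w%:Z)) != 0%N &
     forall i, dim (U i) != 0%N -> (a <= i <= a + w%:Z)])
  \/ ((forall i, dim (U i) = 0%N) /\ w = 0%N).

Definition total_rank U : nat := \big[addn/0%N]_(i \in [set: int]) dim (U i).

Definition width (m : {pred A}) X (w : nat) : Prop :=
  exists2 U, minimal_part m X U & spread U w.

Definition rank (m : {pred A}) X (r : nat) : Prop :=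
  exists2 U, minimal_part m X U & total_rank U = r.

(* Distinguished triangles are those isomorphic to X -> Y -> cone f -> X[1], so a
   strictly full subcategory is triangulated when it is closed under [shift] and
   its inverse and under cones. *)
Record thick (T : complex A -> Prop) : Prop := {
  thick_zero : T zero_cx;
  thick_iso : forall X Y, ho_iso X Y -> T X -> T Y;
  thick_shift : forall X, T X <-> T (shift X);
  thick_cone : forall X Y (f : chain_map X Y), T X -> T Y -> T (cone f);
  thick_summand : forall X Y, T (oplus X Y) -> T X
}.

Definition iso_up_to_shift X Y : Prop :=
  exists n : nat, ho_iso X (iter n shift Y) \/ ho_iso (iter n shift X) Y.

End Complexes.

Section Cohomology.
Variables (A : comNzRingType) (X : complex A).

Definition is_cocycle (i : int) : {pred X i} := fun x => diff X i x == 0.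

Fact cocycle_closed i : submod_closed (@is_cocycle i).
Proof.
split=> [|a x y /eqP dx /eqP dy]; apply/eqP; first exact: linear0.
by rewrite linearP /= dx dy scaler0 addr0.
Qed.
HB.instance Definition _ i :=
  GRing.isSubmodClosed.Build A (X i) (@is_cocycle i) (@cocycle_closed i).

Definition cocycle (i : int) : Type := {x : X i | x \in @is_cocycle i}.
HB.instance Definition _ i := SubChoice.on (cocycle i).
HB.instance Definition _ i := [SubChoice_isSubLmodule of cocycle i by <:].

(* The differential into degree i comes from X j with j + 1 = i. *)
Definition is_coboundary (i : int) : {pred cocycle i} := fun x =>
  `[< exists (j : int) (e : j + 1 = i) (y : X j),
        ecast k (X k) e (diff X j y) = val x >].

Lemma coboundaryP j (x : cocycle (j + 1)) :
  reflect (exists y, diff X j y = val x) (x \in @is_coboundary (j + 1)).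
Proof.
apply: (iffP (asboolP _)) => [[k [e [y <-]]]|[y <-]]; last by exists j, erefl, y.
have kj := addIr _ e; move: e; rewrite -{j x}kj => e.
by exists y; rewrite (eq_axiomK e).
Qed.

Fact coboundary_closed i : submod_closed (@is_coboundary i).
Proof.
have -> : i = (i - 1) + 1 by rewrite subrK.
split; first by apply/coboundaryP; exists 0; rewrite !linear0.
move=> a x y /coboundaryP[x' dx] /coboundaryP[y' dy]; apply/coboundaryP.
by exists (a *: x' + y'); rewrite linearP /= dx dy.
Qed.
Definition cohomology (i : int) : lmodType A := quotient_module (@coboundary_closed i).

Definition total_cohomology : lmodType A := direct_sum cohomology.

End Cohomology.

(* Main.v *)
From HB Require Import structures.
Require Import Defs.
From mathcomp Require Import all_boot all_order all_algebra.
From mathcomp Require Import boolp classical_sets fsbigop zify.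

(* Replace X by its minimal part U. For x in m, the cone C_n of x^n on U is minimal,
   of width at most w + 1 <= 2w and of rank 2r, so the C_n fall into finitely many
   classes up to isomorphism and shift. As x^n kills the cohomology of C_n, some
   fixed x^e kills the cohomology of every C_n. In C_(e+1) this says that
   x^e Z <= x^(e+1) Z + B for the cocycles Z and coboundaries B of U, and Nakayama's
   lemma yields x^e Z <= B. So every x in m acts nilpotently on the finitely
   generated module H^*(X), which therefore has finite length. *)

Set Implicit Arguments.
Unset Strict Implicit.
Unset Printing Implicit Defensive.

Import GRing.Theory VectorInternalTheory.

(** * Noetherian modules and local rings *)

Section NoetherianModules.
Local Open Scope ring_scope.
Variable R : nzRingType.
Implicit Types M : lmodType R.

(** Recursion on the generators replaces an indexed linear combination: peeling off a multiple of
    the head suits inductions that treat one generator at a time. *)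
Fixpoint in_span M (s : seq M) (x : M) : Prop :=
  if s is y :: s' then exists a : R, in_span s' (x - a *: y) else x = 0.

Definition finitely_generated M (N : {pred M}) : Prop :=
  exists2 s : seq M, {subset s <= N} & forall x, x \in N -> in_span s x.

Definition noetherian_module M : Prop :=
  forall N : {pred M}, submod_closed N -> finitely_generated N.

Lemma submod_scale M (N : {pred M}) a x : submod_closed N -> x \in N -> a *: x \in N.
Proof. by move=> [N0 Nl] Nx; rewrite -[_ *: _]addr0 Nl. Qed.

Lemma submod_add M (N : {pred M}) x y :
  submod_closed N -> x \in N -> y \in N -> x + y \in N.
Proof. by move=> [N0 Nl] Nx Ny; rewrite -[x]scale1r Nl. Qed.

Lemma submod_sub M (N : {pred M}) x y :
  submod_closed N -> x \in N -> y \in N -> x - y \in N.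
Proof. by move=> [N0 Nl] Nx Ny; rewrite addrC -scaleN1r Nl. Qed.

Lemma in_span_closed M (N : {pred M}) s x :
  submod_closed N -> {subset s <= N} -> in_span s x -> x \in N.
Proof.
move=> Nsub; elim: s x => [|y s IHs] x sN /=; first by move=> ->; case: Nsub.
case=> a /IHs xaN; rewrite -[x](subrK (a *: y)); apply: submod_add => //.
  by apply: xaN => z zs; apply: sN; rewrite inE zs orbT.
by apply/submod_scale/sN; rewrite ?inE ?eqxx.
Qed.

Lemma in_span_sum M (s : seq M) (c : nat -> R) :
  in_span s (\sum_(k < size s) c k *: s`_k).
Proof.
elim: s c => [|y s IHs] c /=; first by rewrite big_ord0.
exists (c 0%N); rewrite big_ord_recl /= addrAC subrr add0r.
exact: (IHs (c \o succn)).
Qed.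

Lemma in_span_cat M (s t : seq M) x y :
  in_span s x -> in_span t y -> in_span (s ++ t) (x + y).
Proof.
elim: s x => [|z s IHs] x /=; first by move=> ->; rewrite add0r.
by case=> a sx ty; exists a; rewrite addrAC; apply: IHs.
Qed.

Lemma in_span_lift M M' (f : {linear M -> M'}) (t : seq M) z :
  in_span (map f t) z -> exists2 y, in_span t y & f y = z.
Proof.
elim: t z => [|y t IHt] z /=; first by move=> ->; exists 0; rewrite ?linear0.
case=> a /IHt[u tu fu]; exists (u + a *: y); first by exists a; rewrite addrK.
by rewrite linearD linearZ /= fu subrK.
Qed.

(** Generators of the image of [N] lift to [N]. Subtracting a combination of the lifts from an
    element of [N] leaves an element of the kernel, which has its own generators. *)
Lemma finitely_generated_ext M M' (f : {linear M -> M'}) (N : {pred M}) :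
  finitely_generated (fun y => `[< exists2 x, x \in N & f x = y >]) ->
  finitely_generated (fun x => (x \in N) && (f x == 0)) ->
  submod_closed N -> finitely_generated N.
Proof.
move=> [s sN sP] [k kN kP] Nsub.
have [t tN ts] : exists2 t, {subset t <= N} & map f t = s.
  elim: s sN {sP} => [|y s IHs] sN; first by exists [::].
  have [|t tN ts] := IHs; first by move=> z zs; apply: sN; rewrite inE zs orbT.
  have /asboolP[x xN xy] := sN y (mem_head _ _).
  exists (x :: t); last by rewrite /= xy ts.
  by move=> z; rewrite inE => /orP[/eqP->//|/tN].
exists (t ++ k).
  by move=> x; rewrite mem_cat => /orP[/tN//|/kN/andP[]].
move=> x xN; have : in_span s (f x) by apply: sP; apply/asboolP; exists x.
rewrite -ts => /in_span_lift[y ty fy].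
have yN := in_span_closed Nsub tN ty.
rewrite -[x](subrKC y); apply: in_span_cat ty _; apply: kP.
by apply/andP; split; [apply: submod_sub|rewrite linearB /= fy subrr].
Qed.

(** Jointly injective coordinates embed [M] in a finite product of Noetherian modules. Each
    induction step splits off the image of one coordinate and passes to its kernel. *)
Lemma noetherian_components (I : eqType) (s : seq I) M (M_ : I -> lmodType R)
    (p : forall i, {linear M -> M_ i}) :
  (forall i, noetherian_module (M_ i)) ->
  (forall x, {in s, forall i, p i x = 0} -> x = 0) -> noetherian_module M.
Proof.
move=> noethM_ inj_p N Nsub.
(* Restricting injectivity to [N] lets the induction go through: on the kernel of one coordinate the
   remaining ones are still jointly injective. *)
have {inj_p} : {in N, forall x, {in s, forall i, p i x = 0} -> x = 0}.
  by move=> x _; apply: inj_p.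
elim: s N Nsub => [|i s IHs] N Nsub inj_p.
  exists [::] => // x xN; exact: inj_p.
apply: (finitely_generated_ext (f := p i)) (Nsub).
  apply: noethM_; split.
    by apply/asboolP; exists 0; [case: Nsub|rewrite linear0].
  move=> a _ _ /asboolP[x xN <-] /asboolP[y yN <-]; apply/asboolP.
  by exists (a *: x + y); [case: Nsub => _; apply|rewrite linearP].
apply: IHs.
  split; first by apply/andP; rewrite linear0 eqxx; case: Nsub.
  move=> a x y /andP[xN /eqP px] /andP[yN /eqP py]; apply/andP.
  by rewrite linearP /= px py scaler0 addr0 eqxx; split=> //; case: Nsub => _; apply.
move=> x /andP[xN /eqP pix] px; apply: inj_p => // j.
by rewrite inE => /orP[/eqP->//|/px].
Qed.

Lemma noetherian_surj M M' (f : {linear M -> M'}) :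
  (forall y, exists x, f x = y) -> noetherian_module M -> noetherian_module M'.
Proof.
move=> f_surj noethM N Nsub.
have [|s sN sP] := noethM (fun x => f x \in N).
  split; first by rewrite -topredE /= linear0; case: Nsub.
  move=> a x y; rewrite -!topredE /= => fx fy.
  by rewrite linearP; case: Nsub => _; apply.
exists (map f s) => [y /mapP[x /sN xN ->]//|y].
have [x <-] := f_surj y => /sP; elim: s x {sN sP} => [|z s IHs] x /=.
  by move=> ->; rewrite linear0.
by case=> a /IHs; rewrite linearB linearZ /=; exists a.
Qed.

(** Without a maximal element, choice yields a strictly increasing chain from [N0]. Its union is
    finitely generated, hence equal to a member of the chain, a contradiction. *)
Lemma noetherian_maximal M (P : {pred M} -> Prop) (N0 : {pred M}) :
  noetherian_module M -> (forall N, P N -> submod_closed N) -> P N0 ->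
  exists2 N, P N & forall N', P N' -> {subset N <= N'} -> {subset N' <= N}.
Proof.
move=> noethM Psub PN0; apply: contrapT => noMax.
have /choice[next nextP] : forall N, exists N', P N ->
    [/\ P N', {subset N <= N'} & ~ {subset N' <= N}].
  move=> N; have [PN|] := pselect (P N); last by exists N.
  apply: contrapT => no; apply: noMax; exists N => // N' PN' NN'.
  by apply: contrapT => N'N; apply: no; exists N'.
pose C k := iter k next N0.
have PC k : P (C k) by elim: k => //= k /nextP[].
have CS k : {subset C k <= C k.+1} by have [] := nextP _ (PC k).
have Cle j k : (j <= k)%N -> {subset C j <= C k}.
  move/subnK <-; elim: (k - j)%N => // i IHi x /IHi; exact: CS.
have Uc : submod_closed (fun x => `[< exists k, x \in C k >]).
  split; first by apply/asboolP; exists 0%N; case: (Psub _ PN0).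
  move=> a x y /asboolP[j xj] /asboolP[k yk]; apply/asboolP; exists (maxn j k).
  have [_] := Psub _ (PC (maxn j k)); apply.
    exact: Cle (leq_maxl _ _) _ xj.
  exact: Cle (leq_maxr _ _) _ yk.
have [s sU sP] := noethM _ Uc.
have [k sk] : exists k, {subset s <= C k}.
  elim: s sU {sP} => [|y s IHs] sU; first by exists 0%N.
  have [|k sk] := IHs; first by move=> z zs; apply: sU; rewrite inE zs orbT.
  have /asboolP[j yj] := sU y (mem_head _ _); exists (maxn j k) => z.
  rewrite inE => /orP[/eqP->|/sk]; first exact: Cle (leq_maxl _ _) _ yj.
  exact: Cle (leq_maxr _ _) _.
have [_ _ []] := nextP _ (PC k).
move=> x xk; apply: (in_span_closed (Psub _ (PC k)) sk); apply: sP.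
by apply/asboolP; exists k.+1.
Qed.

End NoetherianModules.

(** * Local rings: units, Nakayama's lemma and finite length *)

Section LocalRings.
Local Open Scope ring_scope.
Variables (A : comNzRingType) (m : {pred A}).
Hypotheses (noetherianA : noetherian A) (localA : local_ring m).
Implicit Types M : lmodType A.

Lemma noetherian_regular : noetherian_module A^o.
Proof.
move=> I /noetherianA[s sP]; exists s => [y ys|x /sP[c ->]]; last exact: in_span_sum.
(* A generator [y] lies in [I] as the combination with coefficient 1 at the index of [y] and 0
   elsewhere. *)
apply/sP; exists (fun k => (k == index y s)%:R).
have ks : (index y s < size s)%N by rewrite index_mem.
rewrite (bigD1 (Ordinal ks)) //= eqxx mul1r nth_index // big1 ?addr0 // => k kN.
by rewrite (negbTE kN : (k : nat) == _ = false) mul0r.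
Qed.

Lemma maxideal0 : 0 \in m.
Proof. by case: localA => [[[]]]. Qed.

Lemma maxideal1 : 1 \notin m.
Proof. by case: localA => [[[]]]. Qed.

Lemma maxideal_lin a x y : x \in m -> y \in m -> a * x + y \in m.
Proof. by case: localA => [[[_ _ mP] _] _]; apply: mP. Qed.

Lemma maxideal_mull a x : x \in m -> a * x \in m.
Proof. by move=> mx; rewrite -[_ * _]addr0 maxideal_lin // maxideal0. Qed.

Lemma maxideal_add x y : x \in m -> y \in m -> x + y \in m.
Proof. by move=> mx my; rewrite -[x]mul1r maxideal_lin. Qed.

Lemma maxideal_submod : submod_closed (m : {pred A^o}).
Proof. by split; [exact: maxideal0|move=> a x y; apply: maxideal_lin]. Qed.

(** If [a] had no inverse, its multiples would form a proper ideal. By Noetherianity some ideal is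
    maximal among the proper ideals containing [a]; it is a maximal ideal, hence equal to m. *)
Lemma maxideal_unit a : a \notin m -> exists b, b * a = 1.
Proof.
move=> ma; apply: contrapT => a_nunit.
pose P (I : {pred A^o}) := idealr_closed (I : {pred A}) /\ a \in I.
have [|||I [Iid Ia] Imax] :=
    @noetherian_maximal _ _ P (fun x => `[< exists b, x = b * a >]).
- exact: noetherian_regular.
- by move=> N [[N0 _ Nl] _]; split.
- split; last by apply/asboolP; exists 1; rewrite mul1r.
  split; first by apply/asboolP; exists 0; rewrite mul0r.
    by apply/asboolP => -[b ab]; apply: a_nunit; exists b.
  move=> c _ _ /asboolP[x ->] /asboolP[y ->]; apply/asboolP.
  by exists (c * x + y); rewrite mulrDl mulrA.
have Im : I =i m.
  case: localA => _; apply; split=> // J Jid IJ; apply: Imax => //.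
  by split=> //; apply: IJ.
by case/negP: ma; rewrite -Im.
Qed.

Lemma maxideal_1subM x c : x \in m -> exists b, b * (1 - c * x) = 1.
Proof.
move=> mx; apply: maxideal_unit; apply: contra maxideal1 => m1.
by rewrite -[1](subrK (c * x)) maxideal_add // maxideal_mull.
Qed.

(** This serves to find an element killed by m modulo [N] by treating finitely many ring elements in
    turn. *)
Lemma maxideal_generators : exists2 s : seq A, {subset s <= m} &
  forall (M : lmodType A) (N : {pred M}) v, submod_closed N ->
    {in s, forall x, x *: v \in N} -> forall x, x \in m -> x *: v \in N.
Proof.
have [s sm sP] := noetherian_regular maxideal_submod.
exists s => // M N v Nsub sN x /sP.
elim: s x sN {sm sP} => [|y s IHs] x sN /=.
  by move=> ->; rewrite scale0r; case: Nsub.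
case=> a spx; rewrite -[x](subrK (a * y)) scalerDl; apply: submod_add => //.
  by apply: IHs spx => z zs; apply: sN; rewrite inE zs orbT.
by rewrite -scalerA; apply/submod_scale/sN; rewrite ?inE ?eqxx.
Qed.

(** The last hypothesis reads M = x M + [L]. Generators of M are discarded one by one, because each
    1 - c x is invertible. *)
Lemma nakayama M (L : {pred M}) x :
  finitely_generated (predT : {pred M}) -> submod_closed L -> x \in m ->
  (forall z, exists p, z - x *: p \in L) -> forall z, z \in L.
Proof.
move=> [s _ sP] Lsub mx Lx.
(* Generation is weakened to generation modulo [L], the form that survives the removal of a
   generator. *)
have {sP} : forall z, exists2 y, in_span s y & z - y \in L.
  by move=> z; exists z; [exact: sP|rewrite subrr; case: Lsub].
elim: s => [|v s IHs] sL z; first by have [_ /= ->] := sL z; rewrite subr0.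
suff {z} : forall z, exists2 y, in_span s y & z - y \in L by move/IHs.
(* If v = x p modulo L and p = c v + y modulo L with y in the span of the other
   generators, then (1 - c x) v = x y modulo L, so the generator v is redundant. *)
have spanZ a y : in_span s y -> in_span s (a *: y).
  elim: (s) y => [|u t IHt] y /=; first by move->; rewrite scaler0.
  by case=> b /IHt; rewrite scalerBr scalerA; exists (a * b).
have spanD y y' : in_span s y -> in_span s y' -> in_span s (y + y').
  elim: (s) y y' => [|u t IHt] y y' /=; first by move=> -> ->; rewrite addr0.
  case=> b yb [b' /(IHt _ _ yb) H]; exists (b + b').
  by rewrite scalerDl opprD addrACA.
have [y ys vy] : exists2 y, in_span s y & v - y \in L.
  have [p vpL] := Lx v; have [q [c qs] pqL] := sL p.
  have [b b1] := maxideal_1subM c mx.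
  exists ((b * x) *: (q - c *: v)); first exact: spanZ.
  have -> : v - (b * x) *: (q - c *: v) =
      b *: (v - x *: p) + (b * x) *: (p - q).
    rewrite !scalerBr !scalerA addrA subrK opprB addrA; congr (_ - _).
    rewrite -{1}[v]scale1r -scalerDl; congr (_ *: _).
    by rewrite -b1 mulrBr mulr1 [c * x]mulrC mulrA subrK.
  by apply: submod_add => //; apply: submod_scale.
move=> z; have [u [c us] zuL] := sL z.
exists ((u - c *: v) + c *: y); first by apply/spanD/spanZ.
have -> : z - (u - c *: v + c *: y) = (z - u) + c *: (v - y).
  by rewrite scalerBr opprD opprB !addrA (addrAC z).
by apply: submod_add => //; apply: submod_scale.
Qed.

(** The factor is a copy of A/m. An element a v + n outside [N], with n in [N], has a outside m; so
    a is a unit, and a submodule containing [N] and this element contains [v]. *)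
Lemma simple_factor_adjoin M (N : {pred M}) v :
  submod_closed N -> v \notin N -> (forall x, x \in m -> x *: v \in N) ->
  let N' : {pred M} := fun y => `[< exists a, y - a *: v \in N >] in
  submod_closed N' /\ simple_factor N N'.
Proof.
move=> Nsub vN mv N'.
have NN' : {subset N <= N'}.
  by move=> y yN; apply/asboolP; exists 0; rewrite scale0r subr0.
have vN' : v \in N'.
  by apply/asboolP; exists 1; rewrite scale1r subrr; case: Nsub.
split.
  split; first by apply: NN'; case: Nsub.
  move=> c x y /asboolP[a xa] /asboolP[b yb]; apply/asboolP; exists (c * a + b).
  have -> : c *: x + y - (c * a + b) *: v = c *: (x - a *: v) + (y - b *: v).
    by rewrite scalerDl scalerBr scalerA opprD addrACA.
  by case: Nsub => _; apply.
split=> // [N'N|P Psub NP PN']; first by rewrite (N'N v) in vN.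
have [PN|/existsNP[p /not_implyP[pP pN]]] := pselect {subset P <= N}; first by left.
right; suff vP : v \in P.
  move=> y /asboolP[a ya]; rewrite -[y](subrK (a *: v)).
  by apply: submod_add => //; [exact: NP|exact: submod_scale].
have /asboolP[a paN] := PN' _ pP.
have [|b ba] := @maxideal_unit a.
  apply/negP => /mv avN; apply: pN.
  by rewrite -[p](subrK (a *: v)) submod_add.
rewrite -[v]scale1r -ba -scalerA -[a *: v](subKr p).
by apply: submod_scale => //; apply: submod_sub => //; apply: NP.
Qed.

(** Take [N] maximal among the submodules with a composition series. If [N] were proper, some
    element outside it would be killed by m modulo [N], and adjoining it would lengthen the
    series. *)
Lemma finite_length_torsion M :
  noetherian_module M ->
  (forall x, x \in m -> exists n, forall v : M, x ^+ n *: v = 0) ->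
  finite_length M.
Proof.
move=> noethM Mtors; have [s sm sP] := maxideal_generators.
pose series (N : {pred M}) := exists (n : nat) (C : nat -> {pred M}),
  [/\ forall k, submod_closed (C k), C 0%N =i pred1 0, C n =i N &
      forall k, (k < n)%N -> simple_factor (C k) (C k.+1)].
have eq_sub (N N' : {pred M}) : N =i N' -> submod_closed N -> submod_closed N'.
  by move=> NN' [N0 Nl]; split=> [|a x y]; rewrite -!NN' //; apply: Nl.
have zero_sub : submod_closed (pred1 (0 : M)).
  split=> [|a x y /eqP-> /eqP->]; first exact: eqxx.
  by rewrite scaler0 addr0 inE.
have [||N [n [C [Csub C0 Cn Cfac]]] Nmax] :=
    @noetherian_maximal _ M series (pred1 0) noethM.
- by move=> N [n [C [Csub _ Cn _]]]; apply: eq_sub Cn _.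
- by exists 0%N, (fun=> pred1 0 : {pred M}); split.
exists n, C; split=> // y; rewrite Cn; apply: contrapT => /negP yN0.
have Nsub := eq_sub _ _ Cn (Csub n).
(* For each generator x of m in turn, multiply by the last power of x that keeps the element outside
   [N]. Generators already treated still carry the result into [N]. *)
have {y yN0} [v vN sv] : exists2 v, v \notin N & {in s, forall x, x *: v \in N}.
  have yN : y \notin N by move: yN0; case: (y \in N).
  elim: s y yN sm {sP yN0} => [|x s IHs] y yN sm; first by exists y.
  have [|v vN sv] := IHs _ yN.
    by move=> z zs; apply: sm; rewrite inE zs orbT.
  have [k xkN] : exists k, x ^+ k *: v \in N.
    have [k xk] := Mtors x (sm x (mem_head _ _)); exists k.
    by rewrite xk; case: Nsub.
  have : exists k, x ^+ k *: v \in N by exists k.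
  move/ex_minnP => [[|e]]; first by rewrite scale1r (negbTE vN).
  move=> xeN emin; exists (x ^+ e *: v).
    by apply/negP => /emin; rewrite ltnn.
  move=> z; rewrite inE => /orP[/eqP->|/sv zv]; first by rewrite scalerA -exprS.
  by rewrite scalerA mulrC -scalerA submod_scale.
have [N'sub N'fac] := simple_factor_adjoin Nsub vN (sP _ _ _ Nsub sv).
set N' : {pred M} := fun y => _ in N'sub N'fac.
have [NN' N'N Nsimple] := N'fac; apply: N'N; apply: Nmax => //.
exists n.+1, (fun k => if (k <= n)%N then C k else N'); split=> [k|||k].
- by case: ifP.
- by [].
- by rewrite ltnn.
rewrite ltnS => kn1; have [nk|kn] := leqP n k; last first.
  by rewrite kn1; apply: Cfac.
have -> : k = n by apply/eqP; rewrite eqn_leq kn1 nk.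
rewrite leqnn; split=> [x|N'C|P Psub CP PN'].
- by rewrite Cn; apply: NN'.
- by case: N'fac => _ + _; apply=> x /N'C; rewrite Cn.
have [|PN|N'P] := Nsimple P Psub _ PN'; [by move=> x; rewrite -Cn; apply: CP| |by right].
by left=> x /PN; rewrite Cn.
Qed.

End LocalRings.

(** * Maps that are the identity modulo m *)

Section IdealMultiples.
Local Open Scope ring_scope.
Variables (A : comNzRingType) (m : {pred A}) (localA : local_ring m).
Implicit Types M : lmodType A.

Lemma in_ideal_smul_add M (x y : M) :
  in_ideal_smul m x -> in_ideal_smul m y -> in_ideal_smul m (x + y).
Proof.
move=> [s sm ->] [t tm ->]; exists (s ++ t); last by rewrite big_cat.
by move=> p; rewrite mem_cat => /orP[/sm|/tm].
Qed.

Lemma in_ideal_smul_scale M (a : A) (x : M) : a \in m -> in_ideal_smul m (a *: x).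
Proof.
move=> am; exists [:: (a, x)]; last by rewrite big_seq1.
by move=> p; rewrite inE => /eqP->.
Qed.

Lemma in_ideal_smul_linear M M' (f : M -> M') (x : M) :
  linear f -> in_ideal_smul m x -> in_ideal_smul m (f x).
Proof.
move=> f_lin [s sm ->].
pose F : {linear M -> M'} := HB.pack f (GRing.isLinear.Build A M M' _ f f_lin).
exists [seq (p.1, f p.2) | p <- s]; first by move=> _ /mapP[p /sm pm ->].
rewrite big_map -[LHS]/(F _) linear_sum; apply: eq_bigr => p _.
exact: (linearZ_LR F).
Qed.

Lemma in_ideal_smul_regular (x : A^o) : in_ideal_smul m x -> x \in m.
Proof.
move=> [s sm ->]; rewrite big_seq; apply: (big_ind (fun y : A^o => (y : A) \in m)).
- exact: maxideal0 localA.
- by move=> y z; apply: maxideal_add localA _ _.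
- by move=> p /sm pm; rewrite [_ *: _]mulrC maxideal_mull.
Qed.

(** The determinant is an integer polynomial in the entries, so congruences modulo m pass to it,
    term by term and factor by factor. *)
Lemma det_maxideal n (P Q : 'M[A]_n) :
  (forall i j, P i j - Q i j \in m) -> \det P - \det Q \in m.
Proof.
move=> PQ; rewrite /determinant.
have sub0 (x : A) : x - x \in m by rewrite subrr (maxideal0 localA).
apply: (big_ind2 (fun x y : A => x - y \in m)) => // [x x' y y' xm ym|s _].
  by rewrite opprD addrACA (maxideal_add localA).
rewrite -mulrBr (maxideal_mull localA) //.
apply: (big_ind2 (fun x y : A => x - y \in m)) => // x x' y y' xm ym.
have -> : x * y - x' * y' = y * (x - x') + x' * (y - y').
  by rewrite !mulrBr [y * x]mulrC [y * x']mulrC addrA subrK.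
by rewrite (maxideal_add localA) // (maxideal_mull localA).
Qed.

(** This is the rank inequality over the residue field, without forming that field: if b < a, then
    det (P Q) is 0 and also congruent to 1, so 1 would lie in m. *)
Lemma mx_retract_leq a b (P : 'M[A]_(a, b)) (Q : 'M[A]_(b, a)) :
  (forall i j, (P *m Q) i j - 1%:M i j \in m) -> (a <= b)%N.
Proof.
move=> PQ; rewrite leqNgt; apply/negP => ba.
have [c ac] : exists c, a = (b + c.+1)%N by exists (a - b).-1; lia.
subst a.
have /det_maxideal := PQ; rewrite det1.
(* Padded with zeros, P and Q become square matrices with a zero column and a zero
   row. *)
have -> : P *m Q = row_mx P (0 : 'M_(_, c.+1)) *m col_mx Q (0 : 'M_(c.+1, _)).
  by rewrite mul_row_col mul0mx addr0.
rewrite det_mulmx (expand_det_col _ (rshift b ord0)) big1 ?mul0r; last first.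
  by move=> i _; rewrite row_mxEr mxE mul0r.
rewrite sub0r -mulN1r => /(maxideal_mull localA (-1)).
by rewrite mulrA mulrNN !mulr1 (negbTE (maxideal1 localA)).
Qed.

Lemma dim_retract_leq (V W : vectType A) (F : V -> W) (G : W -> V) :
  linear F -> linear G -> (forall u, in_ideal_smul m (G (F u) - u)) ->
  (dim V <= dim W)%N.
Proof.
move=> F_lin G_lin GF.
pose F' : {linear V -> W} := HB.pack F (GRing.isLinear.Build A V W _ F F_lin).
pose G' : {linear W -> V} := HB.pack G (GRing.isLinear.Build A W V _ G G_lin).
apply: (@mx_retract_leq _ _ (lin1_mx (v2r \o F' \o r2v)) (lin1_mx (v2r \o G' \o r2v))).
move=> i j.
pose u : V := r2v (delta_mx 0 i).
(* A coordinate function is a linear form, so it carries multiples of m into m; this turns the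
   hypothesis into a congruence of matrix entries. *)
have lin_c : linear (fun x : V => v2r x 0 j : A^o).
  by move=> a x y; rewrite linearP !mxE.
have uij : v2r u 0 j = (1%:M : 'M[A]_(dim V)) i j.
  by rewrite r2vK !mxE eqxx eq_sym.
have : v2r (G (F u)) 0 j - v2r u 0 j \in m.
  have := in_ideal_smul_regular (in_ideal_smul_linear lin_c (GF u)).
  by rewrite linearB !mxE.
rewrite uij.
suff -> : v2r (G (F u)) 0 j =
    (lin1_mx (v2r \o F' \o r2v) *m lin1_mx (v2r \o G' \o r2v)) i j.
  by [].
have -> : v2r (G (F u)) =
    delta_mx 0 i *m lin1_mx (v2r \o F' \o r2v) *m lin1_mx (v2r \o G' \o r2v).
  by rewrite !mul_rV_lin1 /= v2rK.
by rewrite -mulmxA -rowE mxE.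
Qed.

End IdealMultiples.

(** * Complexes *)

Section Complexes.
Local Open Scope ring_scope.
Variable A : comNzRingType.
Implicit Types X Y Z U V : complex A.

Lemma linfun_linearE (V W : vectType A) (f : V -> W) :
  linear f -> linfun f =1 f.
Proof.
move=> f_lin.
pose F : {linear V -> W} := HB.pack f (GRing.isLinear.Build A V W _ f f_lin).
exact: (lfunE F).
Qed.

Lemma oplus_diffE X Y i (p : oplus X Y i) :
  diff (oplus X Y) i p = (diff X i p.1, diff Y i p.2).
Proof. exact: linfun_linearE (@oplus_linear A X Y i) p. Qed.

Lemma cone_diffE X Y (f : chain_map X Y) i (p : cone f i) :
  diff (cone f) i p = (- diff X (i + 1) p.1, f (i + 1) p.1 + diff Y i p.2).
Proof. exact: linfun_linearE (@cone_linear A X Y f i) p. Qed.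

Lemma shift_diffE X i (x : shift X i) : diff (shift X) i x = - diff X (i + 1) x.
Proof. by rewrite /= lfunE. Qed.

Lemma chain_mapE X Y (f : chain_map X Y) i x :
  f (i + 1) (diff X i x) = diff Y i (f i x).
Proof. by rewrite -!comp_lfunE cmap_diff. Qed.

(** The identity is stated in degree i + 1, the form of every degree, so that both composites are
    typed without a cast. *)
Definition contractible V : Prop :=
  exists2 h : forall i, V (i + 1) -> V i, forall i, linear (h i) &
    forall i x, x = diff V i (h i x) + h (i + 1) (diff V (i + 1) x).

Lemma contractible_zero : contractible (zero_cx A).
Proof.
exists (fun _ _ => 0) => i; first by move=> a x y; rewrite scaler0 addr0.
by move=> x; apply/rowP => -[].
Qed.

Lemma contractible_oplus X Y :
  contractible X -> contractible Y -> contractible (oplus X Y).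
Proof.
move=> [h h_lin hP] [k k_lin kP].
exists (fun i p => (h i p.1, k i p.2)) => i.
  by move=> a x y; congr (_, _); [apply: h_lin|apply: k_lin].
move=> [x y]; rewrite !oplus_diffE /=.
by apply: (f_equal2 pair); [apply: hP|apply: kP].
Qed.

Lemma contractible_disk n : contractible (disk A n).
Proof.
exists (fun i x => x *m const_mx 1) => i.
  by move=> a x y; rewrite mulmxDl scalemxAl.
move=> x; rewrite /= !lfunE /=.
have nul p q (u : 'rV[A]_p) : q = 0%N ->
    u *m (const_mx 1 : 'M_(p, q)) *m (const_mx 1 : 'M_(q, p)) = 0.
  by move=> q0; subst q; apply/rowP => j; rewrite !mxE big_ord0.
have one p q (u : 'rV[A]_p) : p = 1%N -> q = 1%N ->
    u *m (const_mx 1 : 'M_(p, q)) *m (const_mx 1 : 'M_(q, p)) = u.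
  move=> p1 q1; subst p q; apply/rowP => j.
  by rewrite !mxE big_ord1 !mxE big_ord1 !mxE !mulr1 !ord1.
(* The degree of [x] is i + 1. In degree n the composite through n + 1 is the identity, in degree n
   + 1 the one through n is, and elsewhere [x] is an empty row. *)
have [i1|[i1|i0]] : i + 1 = n \/ i = n \/ (i + 1 <> n /\ i <> n) by lia.
- by rewrite nul ?add0r ?one //; lia.
- by rewrite one ?nul ?addr0 //; lia.
apply/rowP => -[j jl]; exfalso; move: jl; lia.
Qed.

Lemma contractible_disks s : contractible (foldr (@oplus A) (zero_cx A) (map (disk A) s)).
Proof.
elim: s => [|n s IHs]; first exact: contractible_zero.
exact: contractible_oplus (contractible_disk n) IHs.
Qed.

(** Annihilation of the cohomology by [a], expressed on cocycles to avoid quotient modules. *)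
Definition kills (a : A) X : Prop :=
  forall i (z : X (i + 1)), diff X (i + 1) z = 0 -> exists y, diff X i y = a *: z.

Lemma kills_mul a b X : kills a X -> kills (b * a) X.
Proof.
move=> aX i z /aX[y dy]; exists (b *: y).
by rewrite linearZ /= dy scalerA.
Qed.

Lemma contractible_kills a V : contractible V -> kills a V.
Proof.
move=> [h h_lin hP] i z dz; exists (a *: h i z); rewrite linearZ /= {2}(hP i z) dz.
suff -> : h (i + 1) 0 = 0 by rewrite addr0.
by have := h_lin (i + 1) (-1) 0 0; rewrite scaler0 addr0 scaleN1r addNr.
Qed.

Lemma kills_oplus a X Y : kills a X -> kills a Y -> kills a (oplus X Y).
Proof.
move=> aX aY i [x y]; rewrite oplus_diffE => -[/= /aX[x' dx] /aY[y' dy]].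
by exists (x', y'); rewrite oplus_diffE /= dx dy.
Qed.

Lemma kills_shift a X : kills a (shift X) <-> kills a X.
Proof.
split=> aX i.
  rewrite -(subrK 1 i) => z dz; have [|y] := aX (i - 1) z.
    by rewrite shift_diffE dz oppr0.
  by rewrite shift_diffE; exists (- y); rewrite linearN.
move=> z; rewrite shift_diffE => /eqP; rewrite oppr_eq0 => /eqP /aX[y dy].
by exists (- y); rewrite shift_diffE linearN /= opprK.
Qed.

(** For a cocycle z of Y, a g(z) is a coboundary of X. Its image under f is a f(g(z)), and f(g(z))
    differs from z by the coboundary of h(z). *)
Lemma kills_ho_iso a X Y : ho_iso X Y -> kills a X -> kills a Y.
Proof.
move=> [f [g [_ [h hP]]]] aX i z dz.
have [|x dx] := aX i (g (i + 1) z); first by rewrite -chain_mapE dz linear0.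
exists (f i x - a *: h i z); rewrite linearB /= -chain_mapE dx.
rewrite [f _ _]linearZ [diff _ _ _]linearZ /= -scalerBr.
have /lfunP/(_ z) := hP i.
rewrite add_lfunE opp_lfunE add_lfunE !comp_lfunE id_lfunE dz linear0 addr0 => <-.
by rewrite subKr.
Qed.

Lemma ho_iso_sym X Y : ho_iso X Y -> ho_iso Y X.
Proof. by move=> [f [g [? ?]]]; exists g, f. Qed.

Lemma cx_iso_ho_iso X Y : cx_iso X Y -> ho_iso X Y.
Proof.
move=> [f [g fg]]; exists f, g.
by split; exists (fun=> 0) => i; have [gf1 fg1] := fg (i + 1);
  rewrite ?gf1 ?fg1 subrr comp_lfun0r comp_lfun0l addr0.
Qed.

Lemma kills_iter_shift a n X : kills a (iter n (@shift A) X) <-> kills a X.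
Proof. by elim: n => //= n IHn; rewrite kills_shift. Qed.

Lemma kills_iso_up_to_shift a X Y : iso_up_to_shift X Y -> kills a X <-> kills a Y.
Proof.
have iso X' Y' : ho_iso X' Y' -> kills a X' <-> kills a Y'.
  by move=> XY; split; apply: kills_ho_iso => //; apply: ho_iso_sym.
by move=> [n [/iso|/iso]]; rewrite kills_iter_shift.
Qed.

(** * Multiplication by a ring element and its cone *)

Section Homothety.
Variables (a : A) (X : complex A).

Fact homothety_diff i :
  ((a *: \1 : 'Hom(X (i + 1)%R, X (i + 1)%R)) \o diff X i = diff X i \o (a *: \1))%VF.
Proof. by apply/lfunP => x; rewrite !comp_lfunE !scale_lfunE !id_lfunE linearZ. Qed.

Definition homothety : chain_map X X :=
  @ChainMap A X X (fun i => a *: \1%VF) homothety_diff.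

Lemma homothetyE i x : homothety i x = a *: x.
Proof. by rewrite /= scale_lfunE id_lfunE. Qed.

(* Multiplication by a is null-homotopic on the cone of multiplication by a, by the
   homotopy (p, q) |-> (q, 0). *)
Lemma kills_cone_homothety : kills a (cone homothety).
Proof.
move=> i [p q]; rewrite cone_diffE => -[dp dq].
exists (q, 0); rewrite cone_diffE /= linear0 addr0 homothetyE.
apply: (f_equal2 pair) => //=.
by apply/esym/eqP; rewrite -addr_eq0 -homothetyE dq.
Qed.

Lemma minimal_cone_homothety (m : {pred A}) :
  a \in m -> minimal m X -> minimal m (cone homothety).
Proof.
move=> am minX i [p q]; rewrite cone_diffE /= homothetyE.
have -> : (- diff X (i + 1) p, a *: p + diff X i q) =
    (diff X (i + 1) (- p), 0) + (a *: (0, p) + (0, diff X i q)).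
  by apply: (f_equal2 pair); rewrite /= ?linearN ?scaler0 ?addr0 ?add0r.
apply: in_ideal_smul_add; last apply: in_ideal_smul_add.
- apply: (@in_ideal_smul_linear _ _ _ _ (fun x : X (i + 1 + 1) => (x, 0))) => //.
  by move=> c x y; apply: (f_equal2 pair); rewrite /= ?scaler0 ?addr0.
- exact: in_ideal_smul_scale.
- apply: (@in_ideal_smul_linear _ _ _ _ (fun x : X (i + 1) => (0, x))) => //.
  by move=> c x y; apply: (f_equal2 pair); rewrite /= ?scaler0 ?addr0.
Qed.

(** A cocycle z gives the cocycle (0, z) of the cone. If b (0, z) is the coboundary of (p, y), the
    first component makes p a cocycle and the second gives the relation that feeds Nakayama's
    lemma. *)
Lemma cone_homothety_cocycle b : kills b (cone homothety) ->
  forall i (z : X (i + 1)), diff X (i + 1) z = 0 ->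
  exists p y, diff X (i + 1) p = 0 /\ b *: z = a *: p + diff X i y.
Proof.
move=> bC i z dz; have [|[p y]] := bC i (0, z).
  by rewrite cone_diffE /= dz !linear0 addr0.
rewrite cone_diffE /= homothetyE => -[/eqP]; rewrite scaler0 oppr_eq0 => /eqP dp <-.
by exists p, y.
Qed.

End Homothety.

End Complexes.

(** * Minimal parts *)

Section MinimalParts.
Local Open Scope ring_scope.
Variable A : comNzRingType.
Implicit Types X Y Z U V W : complex A.

Fact comp_map_diff X Y Z (g : chain_map Y Z) (f : chain_map X Y) i :
  ((g (i + 1) \o f (i + 1)) \o diff X i = diff Z i \o (g i \o f i))%VF.
Proof. by apply/lfunP => x; rewrite !comp_lfunE !chain_mapE. Qed.

Definition comp_map X Y Z (g : chain_map Y Z) (f : chain_map X Y) : chain_map X Z :=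
  ChainMap (comp_map_diff g f).

Fact inl_map_linear U V i : linear (fun u : U i => (u, 0) : oplus U V i).
Proof. by move=> a u v; apply: (f_equal2 pair); rewrite /= ?scaler0 ?addr0. Qed.

Fact inl_map_diff U V i :
  ((linfun (fun u : U (i + 1) => (u, 0) : oplus U V (i + 1))) \o diff U i =
   diff (oplus U V) i \o linfun (fun u : U i => (u, 0) : oplus U V i))%VF.
Proof.
apply/lfunP => u; rewrite !comp_lfunE !(linfun_linearE (@inl_map_linear U V _)).
by rewrite oplus_diffE linear0.
Qed.

Definition inl_map U V : chain_map U (oplus U V) := ChainMap (@inl_map_diff U V).

Lemma inl_mapE U V i u : inl_map U V i u = (u, 0).
Proof. exact: linfun_linearE (@inl_map_linear U V i) u. Qed.

Fact fst_map_linear U V i : linear (fun p : oplus U V i => p.1).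
Proof. by []. Qed.

Fact fst_map_diff U V i :
  (linfun (fun p : oplus U V (i + 1) => p.1) \o diff (oplus U V) i =
   diff U i \o linfun (fun p : oplus U V i => p.1))%VF.
Proof.
apply/lfunP => u; rewrite !comp_lfunE !(linfun_linearE (@fst_map_linear U V _)).
by rewrite oplus_diffE.
Qed.

Definition fst_map U V : chain_map (oplus U V) U := ChainMap (@fst_map_diff U V).

Lemma fst_mapE U V i p : fst_map U V i p = p.1.
Proof. exact: linfun_linearE (@fst_map_linear U V i) p. Qed.

Variables (m : {pred A}) (localA : local_ring m).

(* With h a contraction of V, the composite U -> W -> U differs from the identity by
   a map that factors through V, hence by a homotopy dk + kd, whose values lie in mU
   because U is minimal. *)
Lemma minimal_retract_dim U W V
    (f : chain_map U (oplus W V)) (g : chain_map (oplus W V) U) :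
  minimal m U -> contractible V -> (forall i u, g i (f i u) = u) ->
  forall i, (dim (U i) <= dim (W i))%N.
Proof.
move=> minU [h h_lin hP] gf i; rewrite -(subrK 1 i); move: (i - 1) => {}i.
apply: (@dim_retract_leq _ _ localA _ _
          (fun u => (f (i + 1) u).1) (fun w => g (i + 1) (w, 0))).
- by move=> a u v; rewrite linearP.
- by move=> a u v; rewrite (inl_map_linear V a u v) linearP.
move=> u; set v := (f (i + 1) u).2.
(* Since g f is the identity, dropping the component [v] of f u changes the value of g by exactly g
   (0, v). *)
have -> : g (i + 1) ((f (i + 1) u).1, 0) - u = - g (i + 1) (0, v).
  rewrite -{2}[u]gf -[RHS]linearN -[LHS]linearB; congr (fun_of_lfun _ _).
  by rewrite {2}[f _ u]surjective_pairing; apply: (f_equal2 pair);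
    rewrite /= ?subrr ?sub0r ?oppr0.
(* In v = d h v + h d v, the second term depends on u only through d u, because f is a chain map. So
   its contribution is the linear map [k] applied to an element of m U. *)
pose k w := - g (i + 1) (0, h (i + 1) (f (i + 1 + 1) w).2).
have snd_lin (j : int) : linear (fun x : V j => (0, x) : oplus W V j).
  by move=> a x y; apply: (f_equal2 pair); rewrite /= ?scaler0 ?addr0.
have -> : - g (i + 1) (0, v) = diff U i (- g i (0, h i v)) + k (diff U (i + 1) u).
  have -> : diff U i (- g i (0, h i v)) = - g (i + 1) (0, diff V i (h i v)).
    have := chain_mapE g (0, h i v).
    by rewrite oplus_diffE linear0 => ->; apply: linearN.
  rewrite /k.
  rewrite [f _ _]chain_mapE oplus_diffE -/v /=.
  rewrite -opprD -linearD; congr (- fun_of_lfun _ _).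
  by apply: (f_equal2 pair); [rewrite /= addr0|apply: hP].
apply: in_ideal_smul_add; first exact: minU.
apply: in_ideal_smul_linear (minU _ _) => a x y.
rewrite /k scalerN -opprD -linearP; congr (- fun_of_lfun _ _).
by rewrite -snd_lin linearP /= h_lin.
Qed.

(** Composing the two decompositions of X exhibits U as a retract of the sum of W and disks, and
    disks are contractible. *)
Lemma minimal_part_dim_leq X U W :
  minimal_part m X U -> minimal_part m X W -> forall i, (dim (U i) <= dim (W i))%N.
Proof.
move=> [minU [s [f [f' ff']]]] [_ [t [g [g' gg']]]].
pose V := foldr (@oplus A) (zero_cx A) (map (disk A) s).
pose phi : chain_map U _ := comp_map g (comp_map f' (inl_map U V)).
apply: (minimal_retract_dim (f := phi)
         (g := comp_map (fst_map U V) (comp_map f g'))) => //.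
  exact: contractible_disks.
move=> i u; rewrite /= !comp_lfunE.
have [/lfunP g'g _] := gg' i; have [_ /lfunP ff'1] := ff' i.
have := g'g (f' i (inl_map U V i u)); rewrite comp_lfunE id_lfunE => ->.
have := ff'1 (inl_map U V i u); rewrite comp_lfunE id_lfunE => ->.
by rewrite fst_mapE inl_mapE.
Qed.

Lemma minimal_part_dim X U W :
  minimal_part m X U -> minimal_part m X W -> forall i, dim (U i) = dim (W i).
Proof.
by move=> XU XW i; apply/eqP; rewrite eqn_leq !(@minimal_part_dim_leq X).
Qed.

Lemma minimal_part_refl U : minimal m U -> minimal_part m U U.
Proof.
move=> minU; split=> //; exists [::].
exists (inl_map U _), (fst_map U _) => i; split; apply/lfunP => u.
  by rewrite comp_lfunE id_lfunE inl_mapE fst_mapE.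
rewrite comp_lfunE id_lfunE inl_mapE fst_mapE.
by rewrite [RHS]surjective_pairing; congr (_, _); apply/rowP => -[].
Qed.

Lemma total_rankE U (s : seq int) : uniq s ->
  (forall i, i \notin s -> dim (U i) = 0%N) -> total_rank U = (\sum_(i <- s) dim (U i))%N.
Proof.
move=> s_uniq sU; rewrite /total_rank (fsbigE s) //; last by move=> i _ /sU.
by apply: eq_bigl => i; rewrite in_setT.
Qed.

Lemma support_seq U :
  exists2 s : seq int, uniq s & forall i, i \notin s -> dim (U i) = 0%N.
Proof.
have [n Un] := bounded U.
exists [seq k%:Z - n%:Z | k <- iota 0 n.*2.+1].
  by rewrite map_inj_uniq ?iota_uniq // => j k; lia.
move=> i is_; apply: Un; rewrite ltnNge; apply: contra is_ => ni.
apply/mapP; exists (absz (i + n%:Z)); last by lia.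
by rewrite mem_iota; lia.
Qed.

Lemma total_rank_gt0 U i : dim (U i) != 0%N -> (0 < total_rank U)%N.
Proof.
move=> Ui; have [s s_uniq sU] := support_seq U; rewrite (total_rankE s_uniq sU).
have is_ : i \in s by apply: contraR Ui => /sU ->.
by rewrite (big_rem i) //= addn_gt0 lt0n Ui.
Qed.

Lemma eq_total_rank U W : (forall i, dim (U i) = dim (W i)) ->
  total_rank U = total_rank W.
Proof. by move=> UW; apply: eq_fsbigr. Qed.

Lemma total_rank_cone X Y (f : chain_map X Y) :
  total_rank (cone f) = (total_rank X + total_rank Y)%N.
Proof.
have [s _ sX] := support_seq X; have [t _ tY] := support_seq Y.
(* A single list covering both supports, that of X lowered by 1 because the cone has X (i + 1) in
   degree i. *)
pose u : seq int := undup ([seq j - 1 | j <- s] ++ t).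
have u_uniq : uniq u by apply: undup_uniq.
have inj1 : injective (fun j : int => j + 1) by move=> j k; lia.
rewrite (@total_rankE _ u) //; last first.
  move=> i; rewrite mem_undup mem_cat => /norP[is_ it].
  rewrite [LHS]/(dim (X (i + 1)%R) + dim (Y i))%N tY // sX //.
  by apply: contra is_ => i1; apply/mapP; exists (i + 1); rewrite ?addrK.
rewrite (@total_rankE X (map (fun j => j + 1) u)); last 2 first.
- by rewrite map_inj_uniq.
- move=> i; apply: contraNeq => Xi; apply/mapP; exists (i - 1); rewrite ?subrK //.
  rewrite mem_undup mem_cat; apply/orP; left; apply/mapP; exists i => //.
  by apply: contraR Xi => /sX ->.
rewrite (@total_rankE Y u) //; last first.
  by move=> i; rewrite mem_undup mem_cat => /norP[_ /tY].
by rewrite big_map -big_split.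
Qed.

(** The cone of a nonzero U has width w + 1, which is at most 2 w once w is positive. If U is zero,
    so is the cone, and both widths are 0 by convention. *)
Lemma spread_cone U (f : chain_map U U) w : (0 < total_rank U -> 0 < w)%N ->
  spread U w -> exists2 w', spread (cone f) w' & (w' <= 2 * w)%N.
Proof.
have dimE i : dim (cone f i) = (dim (U (i + 1)%R) + dim (U i))%N by [].
move=> w_gt0 [[a [Ua Uaw Usupp]]|[U0 ->]]; last first.
  by exists 0%N => //; right; split=> // i; rewrite dimE !U0.
have {}w_gt0 := w_gt0 (total_rank_gt0 Ua).
exists w.+1; last by lia.
(* The shifted copy of U starts at a - 1, while the unshifted one ends at a + w. *)
left; exists (a - 1); split.
- by rewrite dimE subrK; lia.
- rewrite (_ : a - 1 + w.+1%:Z = a + w%:Z); last by lia.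
  by rewrite dimE; lia.
move=> i; rewrite dimE => Ui.
have [/Usupp|/Usupp] : dim (U (i + 1)) != 0%N \/ dim (U i) != 0%N by lia.
  by lia.
by lia.
Qed.

End MinimalParts.

(** * Cohomology *)

Section Cohomology.
Local Open Scope ring_scope.
Variables (A : comNzRingType) (noetherianA : noetherian A).
Implicit Types (X : complex A) (i : int).

Lemma quotient_map_linear (R : nzRingType) (M : lmodType R) (N : {pred M})
  (Nsub : submod_closed N) : linear (quotient_map Nsub).
Proof. by move=> a x y; rewrite quotient_mapD quotient_mapZ. Qed.

Lemma quotient_map0 (R : nzRingType) (M : lmodType R) (N : {pred M})
  (Nsub : submod_closed N) : quotient_map Nsub 0 = 0.
Proof. by rewrite -{1}(scale0r 0) quotient_mapZ; apply: scale0r. Qed.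

(** Coordinates in the free module X i embed the cocycles in a finite power of A. *)
Lemma noetherian_cocycle X i : noetherian_module (cocycle X i).
Proof.
have coord_lin (j : 'I_(dim (X i))) :
    linear (fun z : cocycle X i => v2r (val z) 0 j : A^o).
  move=> a x y; rewrite [val _](_ : _ = a *: val x + val y) //.
  by rewrite linearP !mxE.
pose coord j : {linear cocycle X i -> A^o} :=
  HB.pack (fun z : cocycle X i => v2r (val z) 0 j : A^o)
    (GRing.isLinear.Build A _ _ _ _ (coord_lin j)).
apply: (noetherian_components (s := enum 'I_(dim (X i))) (p := coord)).
  by move=> _; apply: noetherian_regular.
move=> z z0; apply/val_inj/v2r_inj/rowP => j; rewrite linear0 mxE.
by apply: z0; rewrite mem_enum.
Qed.

Lemma noetherian_cohomology X i : noetherian_module (cohomology X i).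
Proof.
pose q : {linear cocycle X i -> cohomology X i} :=
  HB.pack (quotient_map (@coboundary_closed A X i))
    (GRing.isLinear.Build A _ _ _ _
      (quotient_map_linear (@coboundary_closed A X i))).
apply: (noetherian_surj (f := q)); last exact: noetherian_cocycle.
by move=> y; have [x ->] := quotient_mapP y; exists x.
Qed.

Lemma cohomology_eq0 X i : dim (X i) = 0%N -> forall q : cohomology X i, q = 0.
Proof.
move=> Xi0 q; have [x ->] := quotient_mapP q.
have -> : x = 0.
  apply/val_inj/v2r_inj/rowP => j; exfalso.
  by case: j => j; rewrite Xi0.
exact: quotient_map0.
Qed.

Lemma noetherian_total_cohomology X : noetherian_module (total_cohomology X).
Proof.
have [s _ sX] := support_seq X.
have comp_lin i : linear (fun x : total_cohomology X => val x i : cohomology X i).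
  by [].
pose comp i : {linear total_cohomology X -> cohomology X i} :=
  HB.pack (fun x : total_cohomology X => val x i : cohomology X i)
    (GRing.isLinear.Build A _ _ _ _ (comp_lin i)).
apply: (noetherian_components (s := s) (p := comp)).
  exact: noetherian_cohomology.
move=> x x0; apply/val_inj/functional_extensionality_dep => i.
have [/x0//|/sX Xi0] := boolP (i \in s); exact: cohomology_eq0.
Qed.

Lemma kills_cohomology a X i (q : cohomology X i) : kills a X -> a *: q = 0.
Proof.
(* The degree is rewritten as a successor, where coboundaries are plain values of the
   differential. *)
move=> aX; move: q; rewrite -(subrK 1 i); move: (i - 1) => {}i q.
have [x ->] := quotient_mapP q.
rewrite -[a *: _]quotient_mapZ.
suff : a *: x - 0 \in @is_coboundary A X (i + 1).
  by move/quotient_map_eq => ->; apply: quotient_map0.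
rewrite subr0; apply/coboundaryP.
have /eqP dx : is_cocycle (val x) := valP x.
by have [y dy] := aX i (val x) dx; exists y; rewrite dy linearZ.
Qed.

Lemma kills_total_cohomology a X (x : total_cohomology X) : kills a X -> a *: x = 0.
Proof.
move=> aX; apply/val_inj/functional_extensionality_dep => i.
exact: (kills_cohomology (val x i) aX).
Qed.

Variables (m : {pred A}) (localA : local_ring m).

Lemma kills_of_finitely_many_cones x X : x \in m ->
  (exists (k : nat) (Z : 'I_k -> complex A), forall n,
     exists j, iso_up_to_shift (cone (homothety (x ^+ n.+1) X)) (Z j)) ->
  exists e, kills (x ^+ e) X.
Proof.
move=> mx [k [Z XZ]].
(* One cone in class j, say that of x^(n+1), is killed by x^(n+1); this power then kills every cone
   of the class. Classes containing no cone get exponent 0, and the maximum of the exponents serves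
   all classes. *)
have /choice[N NP] : forall j, exists e, forall n,
    iso_up_to_shift (cone (homothety (x ^+ n.+1) X)) (Z j) ->
    kills (x ^+ e) (cone (homothety (x ^+ n.+1) X)).
  move=> j; have [[n nj]|no] := pselect (exists n,
      iso_up_to_shift (cone (homothety (x ^+ n.+1) X)) (Z j)); last first.
    by exists 0%N => n nj; case: no; exists n.
  exists n.+1 => n' /kills_iso_up_to_shift ->.
  by apply/(kills_iso_up_to_shift _ nj)/kills_cone_homothety.
pose e := \max_j N j; exists e.
have {NP XZ} eC n : kills (x ^+ e) (cone (homothety (x ^+ n.+1) X)).
  have [j /NP jP] := XZ n.
  have Ne : (N j <= e)%N by apply: leq_bigmax.
  by rewrite -(subnK Ne) exprD; apply: kills_mul.
move=> i z dz.
(* Nakayama's lemma is applied to the cocycles Z and the submodule [L] of those that x^e sends to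
   coboundaries. *)
pose L : {pred cocycle X (i + 1)} :=
  fun z => `[< exists y, diff X i y = x ^+ e *: val z >].
suff /(_ (Sub z _)) : forall z, z \in L.
  by move/(_ (introT eqP dz))/asboolP.
apply: (nakayama noetherianA localA _ _ mx).
- by apply: noetherian_cocycle; split.
- split; first by apply/asboolP; exists 0; rewrite linear0 scaler0.
  move=> a u v /asboolP[u' du] /asboolP[v' dv]; apply/asboolP.
  rewrite [val _](_ : _ = a *: val u + val v) //.
  by exists (a *: u' + v'); rewrite linearP /= du dv scalerDr !scalerA mulrC.
move=> {z dz} z.
have /eqP dz : is_cocycle (val z) := valP z.
(* The cone of x^(e+1) gives x^e z = x^(e+1) p + d y, so z - x p lies in [L]; hence Z = x Z +
   [L]. *)
have [p [y [/eqP dp zpy]]] := cone_homothety_cocycle (eC e) dz.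
exists (Sub p dp); apply/asboolP; exists y.
rewrite [val _](_ : _ = val z - x *: p) // scalerBr scalerA -exprSr zpy.
by rewrite addrAC subrr add0r.
Qed.

End Cohomology.

Theorem theorem1p7 (A : comNzRingType) (m : {pred A})
  (noetherianA : noetherian A) (localA : local_ring m)
  (T : complex A -> Prop) (thickT : thick T)
  (X : complex A) (TX : T X) (w r : nat)
  (widthX : width m X w) (rankX : rank m X r)
  (nonzero_width : 0 < r -> 0 < w)
  (finiteT : exists (k : nat) (Z : 'I_k -> complex A),
     forall (Y : complex A) (w' r' : nat),
       T Y -> width m Y w' -> rank m Y r' -> w' <= 2 * w -> r' <= 2 * r ->
       exists j : 'I_k, iso_up_to_shift Y (Z j)) :
  finite_length (total_cohomology X).
Proof.
have [U XU Uw] := widthX; have [U' XU' U'r] := rankX.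
(* The given width and rank may come from different minimal parts; these have the same ranks degree
   by degree. *)
have Ur : total_rank U = r.
  by rewrite -U'r; apply/eq_total_rank/(minimal_part_dim localA XU XU').
have [minU [s XUs]] := XU; have XUs' := cx_iso_ho_iso XUs.
have TU : T U by apply/(thick_summand thickT)/(thick_iso thickT XUs' TX).
apply: (finite_length_torsion noetherianA localA).
  exact: noetherian_total_cohomology.
move=> x mx.
have [|e eU] := @kills_of_finitely_many_cones _ noetherianA _ localA x U mx.
  have [k [Z ZP]] := finiteT; exists k, Z => n.
  set f := homothety _ U.
  have minC : minimal m (cone f).
    apply: minimal_cone_homothety => //.
    by rewrite exprSr (maxideal_mull localA).
  (* The bound 2 w on the width of the cone relies on [nonzero_width]. *)
  have [|w' Cw' w'w] := spread_cone f _ Uw; first by rewrite Ur.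
  apply: (ZP _ w' (total_rank (cone f))) => //.
  - exact: thick_cone.
  - by exists (cone f) => //; apply: minimal_part_refl.
  - by exists (cone f) => //; apply: minimal_part_refl.
  - by rewrite total_rank_cone Ur mul2n addnn.
exists e => v; apply: kills_total_cohomology.
(* The result passes from U back to X, since the complementary disks have no cohomology. *)
apply: kills_ho_iso (ho_iso_sym XUs') _; apply: kills_oplus eU _.
exact/contractible_kills/contractible_disks.
Qed.
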